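(* For every $n\ge 2$, $$\sum_{x\in \mathrm{Fib}_n}v(x)\,I_x^2=0,\qquad \sum_{x\in\mathrm{Fib}_n}v(x)\,I_x=2^{\lfloor n/2\rfloor}.$$
   Context: $\mathrm{Fib}_n$ is the set of words $x=x_1x_2\cdots x_r$ in the letters $\{1,2\}$ whose letters sum to $n$ (the elements of rank $n$ of the Fibonacci distributive lattice $\mathrm{Fib}$, whose elements are all words in $\{1,2\}$). $v(x)=(-1)^{a(x)}$, where $a(x)$ is the number of letters $2$ in $x$. For $x=x_1\cdots x_r\in\mathrm{Fib}_n$, a Fibonacci tableau of shape $x$ is a filling $T$, using each of $1,2,\dots,n$ exactly once, of a top-justified array of boxes with $r$ columns in which the $j$-th column (from the left) has $x_j$ boxes, such that the top row is increasing from left to right and each column is increasing from top to bottom. Its reading word $r(T)$ is the permutation obtained by reading the columns from bottom to top, starting with the leftmost column and moving right. $s(T)$ is the sign of the permutation $r(T)$, and $I_x=\sum_T s(T)$, summed over all Fibonacci tableaux $T$ of shape $x$, is the sign-imbalance of $x$. *)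

(* Defs.v *)
From HB Require Import structures.
From mathcomp Require Import all_boot all_order all_fingroup all_algebra.

Set Implicit Arguments.
Unset Strict Implicit.
Unset Printing Implicit Defensive.

Import GRing.Theory.
Local Open Scope ring_scope.

Definition letter : finType := seq_sub [:: 1; 2]%N.

Definition heights (x : seq letter) : seq nat := [seq val l | l <- x].

(* Letters are at least 1, so a word whose letters sum to n has at most
   n letters: bounding the length by n loses no word. *)
Definition Fib (n : nat) : {set n.-bseq letter} :=
  [set x : n.-bseq letter | sumn (heights x) == n].

Definition v (x : seq letter) : int := (-1) ^+ count_mem 2%N (heights x).

(* A filling is the list of its columns, from left to right, each column being
   listed from top to bottom.  The entries 1, ..., n are shifted to
   0, ..., n - 1 in order to live in 'I_n. *)
Definition is_tableau (n : nat) (x : seq letter) (T : seq (seq 'I_n)) : bool :=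
  [&& shape T == heights x,
      perm_eq (flatten T) (enum 'I_n),
      sorted (fun a b : 'I_n => (a < b)%N) (pmap ohead T) &
      all (sorted (fun a b : 'I_n => (a < b)%N)) T].

Definition reading_word (n : nat) (T : seq (seq 'I_n)) : seq 'I_n :=
  flatten [seq rev c | c <- T].

(* The permutation with one-line notation w; the default value 1 is only used
   when w is not a permutation of 'I_n (see word_permE). *)
Definition word_perm (n : nat) (w : seq 'I_n) : 'S_n :=
  insubd (1%g : 'S_n) [ffun k : 'I_n => nth k w k].

Lemma word_permE (n : nat) (w : seq 'I_n) (k : 'I_n) :
  perm_eq w (enum 'I_n) -> word_perm w k = nth k w k.
Proof.
move=> pw; have sw : size w = n by rewrite (perm_size pw) size_enum_ord.
have uw : uniq w by rewrite (perm_uniq pw) enum_uniq.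
rewrite /word_perm -pvalE insubdK ?ffunE //; apply/injectiveP => i j.
rewrite !ffunE (set_nth_default i j) ?sw // => /eqP.
by rewrite nth_uniq ?sw // => /eqP/val_inj.
Qed.

Definition tableau_sign (n : nat) (T : seq (seq 'I_n)) : int :=
  (-1) ^+ odd_perm (word_perm (reading_word T)).

(* Columns have at most two boxes, so the fillings of shape x all occur among
   the (size x)-tuples of sequences of length at most 2. *)
Definition imbalance (x : seq letter) : int :=
  let n := sumn (heights x) in
  \sum_(T : (size x).-tuple (2.-bseq 'I_n)
         | is_tableau x [seq bseqval c | c <- T])
    tableau_sign [seq bseqval c | c <- T].

(* Main.v *)
Require Import Defs.
From mathcomp Require Import all_boot all_order all_fingroup all_algebra.
From mathcomp Require Import zify.

(** Both identities follow from computing what the first letter of a word does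
    to its sign-imbalance.  The top row and the columns of a tableau increase,
    so the smallest entry sits at the top of the first column.

    If the first letter is 1, the first column consists of that smallest entry,
    and deleting it preserves the sign.  Hence I_{1x} = I_x.

    If the first letter is 2, the box below the smallest entry may hold any of
    the remaining entries: it only has to exceed the smallest entry, and it
    imposes nothing on the other columns.  The reading word then starts with
    this entry followed by the smallest one.  Over a remainder of size n, the
    choice k (counted from 0 among the n + 1 larger entries) creates k + 1
    inversions and is independent of the rest of the tableau, so that
    I_{2x} = (sum over k <= n of (-1)^(k + 1)) I_x, which is - I_x if n is even
    and 0 if n is odd ([imbalance_cons2]).

    Splitting the words of rank n + 2 by their first letter, and writing A_n and
    B_n for the sums of v(x) I_x and of v(x) I_x^2, one gets
      A_(n+2) = A_(n+1) + [n even] A_n,   B_(n+2) = B_(n+1) - [n even] B_n,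
    with A_0 = A_1 = B_0 = B_1 = 1.  As A_(n+1) = A_n for n even, A doubles whenever
    the rank becomes even, and B vanishes at ranks 2 and 3, hence from there on.

    Deleting an entry h and renumbering the others is inverse to applying
    [lift h] to all entries.  On permutations this is [lift_perm], whose parity
    is known, so signs are followed without counting inversions. *)

Set Implicit Arguments.
Unset Strict Implicit.
Unset Printing Implicit Defensive.

Import GRing.Theory.
Local Open Scope ring_scope.

Notation ltI := (fun a b : 'I__ => (a < b)%N) (only parsing).

(** * Words of given rank *)

Definition letter1 : letter := @SeqSub _ [:: 1; 2]%N 1%N isT.
Definition letter2 : letter := @SeqSub _ [:: 1; 2]%N 2%N isT.

Lemma letterP (l : letter) : l = letter1 \/ l = letter2.
Proof.
case: l => m m12; have := m12; rewrite !inE => /orP[]/eqP def_m.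
  by left; apply: val_inj.
by right; apply: val_inj.
Qed.

(** The set [Fib n] lives in a type of words that depends on [n]; listing the
    underlying sequences lets words of different ranks be compared. *)
Definition words (n : nat) : seq (seq letter) :=
  [seq bseqval x | x in Fib n].

Lemma words_uniq n : uniq (words n).
Proof. by rewrite map_inj_uniq ?enum_uniq //; apply: val_inj. Qed.

Lemma leq_size_heights (x : seq letter) : (size x <= sumn (heights x))%N.
Proof.
elim: x => //= l x IHx; rewrite -add1n leq_add //.
by case: (letterP l) => ->.
Qed.

Lemma mem_words n x : (x \in words n) = (sumn (heights x) == n).
Proof.
apply/imageP/idP => [[y] | sum_x]; first by rewrite inE => ? ->.
have size_x: (size x <= n)%N by rewrite -(eqP sum_x) leq_size_heights.
by exists (Bseq size_x); rewrite ?inE.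
Qed.

Lemma words_cons n :
  perm_eq (words n.+2)
    (map (cons letter1) (words n.+1) ++ map (cons letter2) (words n)).
Proof.
have inj_cons (l : letter) : injective (cons l) by move=> x y [].
apply: uniq_perm; first exact: words_uniq.
  rewrite cat_uniq !(map_inj_uniq (inj_cons _)) !words_uniq /= andbT.
  by apply/hasPn=> _ /mapP[x _ ->]; apply/mapP=> -[].
case=> [|l x].
  by rewrite mem_cat mem_words; apply/esym/norP; split; apply/mapP=> -[].
rewrite mem_cat mem_words; case: (letterP l) => -> /=.
  rewrite mem_map // mem_words add1n eqSS [X in _ || X](_ : _ = false) ?orbF //.
  by apply/mapP => -[].
rewrite mem_map // mem_words !addSn !eqSS [X in X || _](_ : _ = false) //.
by apply/mapP => -[].
Qed.

Lemma sum_Fib (F : seq letter -> int) n :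
  \sum_(x in Fib n) F x = \sum_(x <- words n) F x.
Proof. by rewrite big_image. Qed.

Lemma sum_Fib_rec (F : seq letter -> int) n :
  \sum_(x in Fib n.+2) F x =
    \sum_(x in Fib n.+1) F (letter1 :: x) + \sum_(x in Fib n) F (letter2 :: x).
Proof.
rewrite sum_Fib (perm_big _ (words_cons n)) big_cat /=.
rewrite (sum_Fib (fun x => F (letter1 :: x))).
rewrite (sum_Fib (fun x => F (letter2 :: x))).
by rewrite !(big_map (cons _)).
Qed.

Lemma sum_Fib0 (F : seq letter -> int) : \sum_(x in Fib 0) F x = F [::].
Proof.
rewrite sum_Fib (perm_big [:: [::]]) ?big_seq1 //.
apply: uniq_perm; rewrite ?words_uniq // => -[|l x]; rewrite mem_words //.
by case: (letterP l) => ->.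
Qed.

Lemma sum_Fib1 (F : seq letter -> int) : \sum_(x in Fib 1) F x = F [:: letter1].
Proof.
rewrite sum_Fib (perm_big [:: [:: letter1]]) ?big_seq1 //.
apply: uniq_perm; rewrite ?words_uniq // => -[|l [|m x]]; rewrite mem_words //.
  by case: (letterP l) => ->.
by rewrite inE; case: (letterP l) => ->; case: (letterP m) => ->.
Qed.

(** * Tableaux of given shape *)

(** As for [words]: the index type of the sum defining [imbalance] depends on
    the shape, whereas bare lists of columns can be extended by a column. *)
Definition tableaux n (x : seq letter) : seq (seq (seq 'I_n)) :=
  [seq [seq bseqval c | c <- tval T]
     | T : (size x).-tuple (2.-bseq 'I_n)
       in [pred T | is_tableau x [seq bseqval c | c <- tval T]]].

Lemma tableaux_uniq n x : uniq (tableaux n x).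
Proof.
rewrite map_inj_uniq ?enum_uniq // => T U /inj_map eqTU.
by apply/val_inj/eqTU/val_inj.
Qed.

Lemma size_heights_le2 (x : seq letter) : all (leq^~ 2) (heights x).
Proof. by elim: x => //= l x ->; case: (letterP l) => ->. Qed.

Lemma mem_tableaux n x (T : seq (seq 'I_n)) :
  (T \in tableaux n x) = is_tableau x T.
Proof.
apply/imageP/idP => [[U tU ->] // | tT].
have [/eqP shT _ _ _] := and4P tT.
have size_T : size (map (@insub_bseq 2 _) T) == size x.
  by rewrite size_map -(size_map size) -/(shape T) shT size_map.
have T_K : [seq bseqval c | c <- map (@insub_bseq 2 _) T] = T.
  rewrite -map_comp map_id_in // => c cT; rewrite /= /insub_bseq.
  rewrite -/(val _) insubdK // unfold_in.
  have := size_heights_le2 x; rewrite -shT => /allP; apply.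
  exact: map_f.
by exists (Tuple size_T); rewrite ?inE /= T_K.
Qed.

Lemma imbalanceE x :
  imbalance x = \sum_(T <- tableaux (sumn (heights x)) x) tableau_sign T.
Proof. by rewrite big_image. Qed.

(** * Renumbering the entries of a filling *)

(** Makes room for the entry [h] by shifting up all entries from [h] on. *)
Definition lift_filling n (h : 'I_n.+1) : seq (seq 'I_n) -> seq (seq 'I_n.+1) :=
  map (map (lift h)).

Section LiftFilling.
Variables (n : nat) (h : 'I_n.+1).
Implicit Type T : seq (seq 'I_n).

Lemma lift_filling_inj : injective (lift_filling h).
Proof. exact/inj_map/inj_map/lift_inj. Qed.

Lemma shape_lift_filling T : shape (lift_filling h T) = shape T.
Proof. by rewrite /shape -map_comp; apply: eq_map => c /=; rewrite size_map. Qed.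

Lemma flatten_lift_filling T :
  flatten (lift_filling h T) = map (lift h) (flatten T).
Proof. by rewrite map_flatten. Qed.

Lemma tops_lift_filling T :
  pmap ohead (lift_filling h T) = map (lift h) (pmap ohead T).
Proof. by elim: T => //= -[|a c] T /= ->. Qed.

Lemma reading_word_lift_filling T :
  reading_word (lift_filling h T) = map (lift h) (reading_word T).
Proof.
rewrite /reading_word map_flatten -!map_comp.
by congr flatten; apply: eq_map => c /=; rewrite map_rev.
Qed.

Lemma sorted_lift (s : seq 'I_n) : sorted ltI (map (lift h) s) = sorted ltI s.
Proof.
by apply: mono_sorted => a b; rewrite !ltnNge /= leq_bump2.
Qed.

Lemma columns_lift_filling T :
  all (sorted ltI) (lift_filling h T) = all (sorted ltI) T.
Proof. by rewrite all_map; apply: eq_all => c /=; rewrite sorted_lift. Qed.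

Lemma lift_filling_surj (T : seq (seq 'I_n.+1)) :
  h \notin flatten T -> exists U, T = lift_filling h U.
Proof.
elim: T => [|c T IHT]; first by exists [::].
rewrite /= mem_cat negb_or => /andP[hc /IHT[U ->]].
suff [d ->] : exists d, c = map (lift h) d by exists (d :: U).
elim: c hc {T U IHT} => [|a c IHc]; first by exists [::].
rewrite inE negb_or => /andP[ha /IHc[d ->]].
by have [b ->] := unlift_some ha; exists (b :: d).
Qed.

Lemma perm_enum_lift (s : seq 'I_n) :
  perm_eq (h :: map (lift h) s) (enum 'I_n.+1) = perm_eq s (enum 'I_n).
Proof.
have enum_lift: perm_eq (enum 'I_n.+1) (h :: map (lift h) (enum 'I_n)).
  apply: uniq_perm; rewrite ?enum_uniq //=.
    rewrite map_inj_uniq ?enum_uniq ?andbT; last exact: lift_inj.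
    by apply/mapP=> -[i _ /eqP]; apply/negP/neq_lift.
  move=> i; rewrite mem_enum !inE; case: (unliftP h i) => [j ->|->]; last first.
    by rewrite eqxx.
  by rewrite map_f ?mem_enum ?orbT.
rewrite (permPr enum_lift) perm_cons; apply/idP/idP; last exact: perm_map.
exact/perm_map_inj/lift_inj.
Qed.

(** An initial letter [h] is greater than exactly [h] of the letters that
    follow it. *)
Lemma odd_word_perm_cons (w : seq 'I_n) : perm_eq w (enum 'I_n) ->
  odd_perm (word_perm (h :: map (lift h) w)) = odd h (+) odd_perm (word_perm w).
Proof.
move=> pw; rewrite -[odd h]/(odd (ord0 : 'I_n.+1) (+) odd h) -odd_lift_perm.
congr odd_perm; apply/permP=> i; rewrite word_permE ?perm_enum_lift //.
case: (unliftP ord0 i) => [j|] ->; last by rewrite lift_perm_id.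
rewrite lift_perm_lift word_permE //= (nth_map j) //.
by rewrite (perm_size pw) size_enum_ord ltn_ord.
Qed.

End LiftFilling.

(** * Deleting the first column *)

Lemma perm_reading_word n (T : seq (seq 'I_n)) :
  perm_eq (reading_word T) (flatten T).
Proof. by elim: T => //= c T IHT; rewrite perm_cat // perm_rev. Qed.

(** The smallest entry is at the top of its column because columns increase,
    and that column comes first because the top row increases. *)
Lemma first_entry n l x (T : seq (seq 'I_n.+1)) :
  is_tableau (l :: x) T -> exists c U, T = (ord0 :: c) :: U.
Proof.
case: T => [|[|a c] U] /and4P[/eqP[]] //; first by case: (letterP l) => ->.
move=> _ shU pT topT colT.
suff -> : ord0 = a by exists c, U.
have: ord0 \in flatten ((a :: c) :: U) by rewrite (perm_mem pT) mem_enum.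
case/flattenP=> d dT d0; apply/val_inj/eqP; rewrite eq_sym -leqn0 /=.
have trI : transitive (ltI : rel 'I_n.+1) by move=> ? ? ? /=; apply: ltn_trans.
have head_d b e : d = b :: e -> (b <= 0)%N.
  move=> def_d; move/allP/(_ d dT): colT d0.
  rewrite def_d /= inE => /(order_path_min trI)/allP min_b.
  by case/predU1P => [<- // | /min_b].
move: dT d0; rewrite inE => /predU1P[def_d _ | dU].
  exact: head_d def_d.
case def_d: d => [//|b e] _; have := head_d _ _ def_d; apply: leq_trans.
move/(order_path_min trI)/allP: topT => min_a.
have topU : b \in pmap ohead U.
  by rewrite mem_pmap; apply/mapP; exists d; rewrite // def_d.
exact/ltnW/(min_a b topU).
Qed.

Lemma is_tableau_cons1 n x (T : seq (seq 'I_n)) :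
  is_tableau (letter1 :: x) ([:: ord0] :: lift_filling ord0 T) = is_tableau x T.
Proof.
rewrite /is_tableau /= eqseq_cons eqxx /= -/(shape _) shape_lift_filling.
rewrite flatten_lift_filling perm_enum_lift tops_lift_filling.
rewrite columns_lift_filling path_min_sorted ?sorted_lift //.
by rewrite all_map; apply/allP.
Qed.

Lemma lift_lift0 n (k : 'I_n.+1) (i : 'I_n) :
  lift ord0 (lift k i) = lift (lift ord0 k) (lift ord0 i).
Proof. by apply: val_inj; rewrite /= /bump /=; lia. Qed.

(** Renumbering by [k] and then by [ord0] leaves free exactly the two entries of
    the new column, whose bottom one ranges over all nonminimal entries. *)
Definition add_column2 n (k : 'I_n.+1) (T : seq (seq 'I_n)) :=
  [:: ord0; lift ord0 k] :: lift_filling ord0 (lift_filling k T).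

Lemma is_tableau_cons2 n k x (T : seq (seq 'I_n)) :
  is_tableau (letter2 :: x) (add_column2 k T) = is_tableau x T.
Proof.
rewrite /is_tableau /= eqseq_cons eqxx /= -/(shape _) !shape_lift_filling.
rewrite flatten_lift_filling -(map_cons _ k) perm_enum_lift.
rewrite flatten_lift_filling perm_enum_lift.
rewrite tops_lift_filling !columns_lift_filling.
rewrite path_min_sorted ?sorted_lift ?tops_lift_filling ?sorted_lift //.
by rewrite all_map; apply/allP.
Qed.

Lemma tableaux_cons1 n x :
  perm_eq (tableaux n.+1 (letter1 :: x))
    [seq [:: ord0] :: lift_filling ord0 T | T <- tableaux n x].
Proof.
apply: uniq_perm; rewrite ?tableaux_uniq //.
  rewrite map_inj_uniq ?tableaux_uniq // => T U [].
  exact: lift_filling_inj.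
move=> T; rewrite mem_tableaux; apply/idP/mapP => [tT | [U]]; last first.
  by rewrite mem_tableaux => tU ->; rewrite is_tableau_cons1.
have [c [U def_T]] := first_entry tT; have [/eqP shT pT _ _] := and4P tT.
move: shT pT; rewrite def_T /= => -[/size0nil c0 _] /perm_uniq.
rewrite enum_uniq c0 => /andP[/lift_filling_surj[V defU] _].
have defT : T = [:: ord0] :: lift_filling ord0 V by rewrite def_T c0 defU.
exists V; last by rewrite defU.
by rewrite mem_tableaux -is_tableau_cons1 -defT.
Qed.

Lemma tableaux_cons2 n x :
  perm_eq (tableaux n.+2 (letter2 :: x))
    [seq add_column2 k T | k <- enum 'I_n.+1, T <- tableaux n x].
Proof.
apply: uniq_perm; rewrite ?tableaux_uniq //.
  apply: allpairs_uniq; rewrite ?enum_uniq ?tableaux_uniq //.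
  move=> [k T] [l U] _ _ [/val_inj <-] /lift_filling_inj/lift_filling_inj.
  by move->.
move=> T; rewrite mem_tableaux; apply/idP/allpairsP => [tT | [[k U] []]] /=.
  have [c [U def_T]] := first_entry tT; have [/eqP shT pT _ _] := and4P tT.
  move: shT pT; rewrite def_T /= => -[].
  case: c def_T => [|b []] // def_T _ _ pT.
  have := perm_uniq pT; rewrite enum_uniq /= inE negb_or => /andP[/andP[b0]].
  have [k def_b _] := unlift_some b0.
  case/lift_filling_surj=> V defU _.
  move: pT; rewrite defU def_b /= flatten_lift_filling.
  rewrite -(map_cons _ k) perm_enum_lift.
  move/perm_uniq; rewrite enum_uniq /= => /andP[/lift_filling_surj[W defV] _].
  have defT : T = add_column2 k W by rewrite def_T def_b defU defV.
  exists (k, W); split; rewrite ?mem_enum //=; last by rewrite defV.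
  by rewrite mem_tableaux -(is_tableau_cons2 k) -defT.
by move=> _ /=; rewrite mem_tableaux => tU ->; rewrite is_tableau_cons2.
Qed.

Lemma tableau_sign_cons1 n x (T : seq (seq 'I_n)) : is_tableau x T ->
  tableau_sign ([:: ord0] :: lift_filling ord0 T) = tableau_sign T.
Proof.
case/and4P=> _ pT _ _; rewrite /tableau_sign.
rewrite {1}/reading_word /= -/(reading_word _) reading_word_lift_filling.
by rewrite odd_word_perm_cons // (permPl (perm_reading_word T)).
Qed.

(** The entry [lift ord0 k] opens the reading word and accounts for [k + 1]
    inversions; the smallest entry, which comes next, accounts for none. *)
Lemma tableau_sign_cons2 n k x (T : seq (seq 'I_n)) : is_tableau x T ->
  tableau_sign (add_column2 k T) = (-1) ^+ k.+1 * tableau_sign T.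
Proof.
case/and4P=> _ pT _ _; rewrite /tableau_sign.
rewrite {1}/reading_word /= -/(reading_word _) !reading_word_lift_filling.
(* The letters are read as lift ord0 k, then ord0, so the renumberings have to
   be exchanged for the one by lift ord0 k to be outermost. *)
rewrite -map_comp (eq_map (lift_lift0 k)) map_comp.
rewrite -[ord0](_ : lift (lift ord0 k) (ord0 : 'I_n.+1) = _); last exact: val_inj.
have pw : perm_eq (reading_word T) (enum 'I_n).
  by rewrite (permPl (perm_reading_word T)).
rewrite -map_cons !odd_word_perm_cons ?perm_enum_lift //=.
by rewrite signr_addb add0n -[(-1) ^+ k.+1]signr_odd.
Qed.

(** * First-letter recursion for the sign-imbalance *)

Lemma imbalance_nil : imbalance [::] = 1.
Proof.
rewrite imbalanceE (perm_big [:: [::]]) ?big_seq1 /tableau_sign.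
  by rewrite (_ : word_perm _ = 1%g) ?odd_perm1 //; apply/permP => -[].
apply: uniq_perm; rewrite ?tableaux_uniq // => T.
rewrite mem_tableaux inE; apply/idP/eqP => [/andP[/eqP]|->]; first by case: T.
by rewrite /is_tableau /= andbT; apply: uniq_perm; rewrite ?enum_uniq // => -[].
Qed.

Lemma imbalance_cons1 x : imbalance (letter1 :: x) = imbalance x.
Proof.
rewrite !imbalanceE /= add1n (perm_big _ (tableaux_cons1 _ _)) big_map.
apply: eq_big_seq => T; rewrite mem_tableaux; exact: tableau_sign_cons1.
Qed.

Lemma sum_signs n : \sum_(k < n.+1) (-1) ^+ k.+1 = - (~~ odd n)%:R :> int.
Proof.
elim: n => [|n IHn]; first by rewrite big_ord_recr big_ord0.
rewrite big_ord_recr /= IHn -signr_odd /=; by case: (odd n).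
Qed.

(** The bottom entry of the first column is chosen independently of the other
    columns, so the signed sum factors. *)
Lemma imbalance_cons2 x :
  imbalance (letter2 :: x) = - (~~ odd (sumn (heights x)))%:R * imbalance x.
Proof.
rewrite !imbalanceE /= add2n (perm_big _ (tableaux_cons2 _ _)).
rewrite big_allpairs_dep big_enum -sum_signs mulr_suml; apply: eq_bigr => k _.
rewrite mulr_sumr; apply: eq_big_seq => T; rewrite mem_tableaux.
exact: tableau_sign_cons2.
Qed.

(** * The two sums *)

Lemma v_cons1 x : v (letter1 :: x) = v x.
Proof. by []. Qed.

Lemma v_cons2 x : v (letter2 :: x) = - v x.
Proof. by rewrite /v /= exprS mulN1r. Qed.

(** At even rank, prefixing 2 changes the sign of both [v] and the imbalance, so
    the two signs cancel here; only that of [v] is left once the imbalance is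
    squared.  At odd rank the imbalance becomes 0. *)
Lemma sum_imbalance_rec n :
  \sum_(x in Fib n.+2) v x * imbalance x =
  \sum_(x in Fib n.+1) v x * imbalance x
    + (~~ odd n)%:R * \sum_(x in Fib n) v x * imbalance x.
Proof.
rewrite (sum_Fib_rec (fun x => v x * imbalance x)); congr (_ + _).
  by apply: eq_bigr => x _; rewrite v_cons1 imbalance_cons1.
rewrite mulr_sumr; apply: eq_bigr => x; rewrite inE => /eqP sum_x.
by rewrite v_cons2 imbalance_cons2 sum_x !mulNr mulrN opprK mulrCA.
Qed.

Lemma sum_imbalance_sqr_rec n :
  \sum_(x in Fib n.+2) v x * imbalance x ^+ 2 =
  \sum_(x in Fib n.+1) v x * imbalance x ^+ 2
    - (~~ odd n)%:R * \sum_(x in Fib n) v x * imbalance x ^+ 2.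
Proof.
rewrite (sum_Fib_rec (fun x => v x * imbalance x ^+ 2)); congr (_ + _).
  by apply: eq_bigr => x _; rewrite v_cons1 imbalance_cons1.
rewrite mulr_sumr -sumrN; apply: eq_bigr => x; rewrite inE => /eqP sum_x.
rewrite v_cons2 imbalance_cons2 sum_x exprMn sqrrN mulNr.
by case: (odd n); rewrite ?expr1n ?mul1r // expr0n !(mul0r, mulr0).
Qed.

Lemma sum_imbalance n : \sum_(x in Fib n) v x * imbalance x = 2 ^+ n./2.
Proof.
pose A n : int := \sum_(x in Fib n) v x * imbalance x.
suff [] : A n = 2 ^+ n./2 /\ A n.+1 = 2 ^+ n.+1./2 by [].
elim: n => [|n [IHn IHn1]].
  rewrite /A (sum_Fib0 (fun x => v x * imbalance x)).
  rewrite (sum_Fib1 (fun x => v x * imbalance x)).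
  by rewrite imbalance_cons1 imbalance_nil.
split=> //; rewrite /A sum_imbalance_rec -/(A _) -/(A _) IHn IHn1 /= uphalf_half.
case: (odd n); rewrite ?(mul0r, addr0) //= add0n mul1r exprS.
by rewrite -mulr2n mulr_natl.
Qed.

Lemma sum_imbalance_sqr n : \sum_(x in Fib n.+2) v x * imbalance x ^+ 2 = 0.
Proof.
pose B n : int := \sum_(x in Fib n) v x * imbalance x ^+ 2.
have B0 : B 0%N = 1.
  by rewrite /B (sum_Fib0 (fun x => v x * imbalance x ^+ 2)) imbalance_nil.
have B1 : B 1%N = 1.
  rewrite /B (sum_Fib1 (fun x => v x * imbalance x ^+ 2)).
  by rewrite imbalance_cons1 imbalance_nil.
have Brec m : B m.+2 = B m.+1 - (~~ odd m)%:R * B m.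
  exact: sum_imbalance_sqr_rec.
suff [] : B n.+2 = 0 /\ B n.+3 = 0 by [].
elim: n => [|n [IHn IHn1]]; first by rewrite !Brec B0 B1.
by split=> //; rewrite Brec IHn1 IHn mulr0 subr0.
Qed.

Theorem theorem5p9 (n : nat) (hn : (2 <= n)%N) :
  \sum_(x in Fib n) v x * imbalance x ^+ 2 = 0 /\
  \sum_(x in Fib n) v x * imbalance x = 2 ^+ (n %/ 2).
Proof.
split; last by rewrite divn2 sum_imbalance.
by case: n hn => [|[|n]] // _; apply: sum_imbalance_sqr.
Qed.
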